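(* Let $\mathbb{F}=\mathbb{F}_2$ and let $P$ be the free $\mathbb{F}[U,V]$-module on the $17$ generators $a$ and $e_j,f_j$, $e'_j,f'_j$ for $j\in\{1,2,3,4\}$, with differential $$\partial a=0,\qquad \partial e_1=\partial f_1=0,$$ $$\partial e_2=V^2e_1,\quad \partial f_2=V^2f_1,\quad \partial e_3=U^2f_1,\quad \partial f_3=U^2(e_1+f_1),$$ $$\partial e_4=U^2e_2+V^2e_3+UV(e'_1+f'_1),\quad \partial f_4=U^2f_2+V^2f_3+UVe'_1,$$ $$\partial e'_1=UVe_1,\quad \partial f'_1=UVf_1,\quad \partial e'_2=V^2e'_1+UVe_2,\quad \partial f'_2=V^2f'_1+UVf_2,$$ $$\partial e'_3=U^2f'_1+UVe_3,\quad \partial f'_3=U^2(e'_1+f'_1)+UVf_3,$$ $$\partial e'_4=U^2e'_2+V^2e'_3+UVe_4,\quad \partial f'_4=U^2f'_2+V^2f'_3+UVf_4,$$ with the $\mathbb{Z}\oplus\mathbb{Z}$ grading determined by $\mathrm{gr}(a)=\mathrm{gr}(f'_4)=(0,0)$. The knot Floer-like complex $P$ has the following property: it is not chain homotopy equivalent to any knot Floer-like complex that admits a simultaneously horizontally and vertically simplified basis.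
   Context: $\mathbb{F}[U,V]$ is $\mathbb{Z}\oplus\mathbb{Z}$ graded by $\mathrm{gr}=(\mathrm{gr}_U,\mathrm{gr}_V)$ with $\mathrm{gr}(U)=(-2,0)$, $\mathrm{gr}(V)=(0,-2)$. All modules and complexes are $\mathbb{Z}\oplus\mathbb{Z}$ graded; a chain complex $(C,\partial)$ is a graded module with a module endomorphism $\partial$ of degree $(-1,-1)$, $\partial^2=0$. Bases are homogeneous, chain maps preserve the grading, chain homotopies have degree $(1,1)$, $\simeq$ is chain homotopy equivalence. $C/U$, $C/V$ denote $C$ with $U=0$, respectively $V=0$. A knot Floer-like complex is a finitely generated free chain complex $C$ over $\mathbb{F}[U,V]$ that is symmetric, i.e. $C\simeq\overline{C}$ where $\overline{C}$ is $C$ with the roles of $U$ and $V$ interchanged and $\mathrm{gr}_U,\mathrm{gr}_V$ switched, and has the homology of a knot in $S^3$: $H_*(C/U)/(V\text{-torsion})\cong\mathbb{F}[V]$ with generator in $\mathrm{gr}_U=0$, and $H_*(C/V)/(U\text{-torsion})\cong\mathbb{F}[U]$ with generator in $\mathrm{gr}_V=0$. A basis $\{z_1,\dots,z_n\}$ of $C$ is vertically simplified if for each $i$ exactly one of the following holds in $C/U$: (1) $\partial z_i=V^az_j$ for some $j$ and $a\in\mathbb{N}_0$; (2) $\partial z_i=0$ and there is at most one pair $(j,a)$, $a\in\mathbb{N}_0$, with $\partial z_j=V^az_i$. It is horizontally simplified if the same holds in $C/V$ with $U$ in place of $V$. *)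

(* Defs.v *)
From HB Require Import structures.
From mathcomp Require Import all_boot all_order all_algebra all_fingroup.
From mathcomp Require Import mpoly ring.

Set Implicit Arguments.
Unset Strict Implicit.
Unset Printing Implicit Defensive.

Import GRing.Theory.
Local Open Scope ring_scope.

Notation FUV := {mpoly 'F_2[2]}.

Definition U : FUV := 'X_(ord0 : 'I_2).
Definition V : FUV := 'X_(ord_max : 'I_2).

(* (gr_U, gr_V); U and V have bidegrees (-2, 0) and (0, -2). *)
Notation bideg := (int * int)%type.

Definition monomial_bideg (m : 'X_{1..2}) : bideg :=
  (- (2 * m ord0)%N%:Z, - (2 * m ord_max)%N%:Z).

(* The zero polynomial is homogeneous of every bidegree. *)
Definition poly_homogeneous (d : bideg) (p : FUV) : Prop :=
  forall m, m \in msupp p -> monomial_bideg m = d.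

Definition swapUV : {rmorphism FUV -> FUV} := msym (tperm ord0 ord_max).

Lemma swapUVK : involutive swapUV.
Proof. by move=> p; rewrite /swapUV /= -msymMm tperm2 msym1m. Qed.

(* [hom d] is the homogeneous part of bidegree d; by [hom_span] and [hom_indep]
   the module is the internal direct sum of its homogeneous parts. *)

Record complex := Complex {
  cmod :> lmodType FUV;
  hom : bideg -> cmod -> Prop;
  diff : {linear cmod -> cmod};
  hom0 : forall d, hom d 0;
  homB : forall d x y, hom d x -> hom d y -> hom d (x - y);
  homZ : forall d e p x,
    poly_homogeneous d p -> hom e x -> hom (d + e) (p *: x);
  hom_span : forall x, exists (s : seq bideg) (c : bideg -> cmod),
    (forall d, hom d (c d)) /\ x = \sum_(d <- s) c d;
  hom_indep : forall (s : seq bideg) (c : bideg -> cmod), uniq s ->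
    (forall d, hom d (c d)) -> \sum_(d <- s) c d = 0 ->
    forall d, d \in s -> c d = 0;
  diff_hom : forall d x, hom d x -> hom (d - (1, 1)) (diff x);
  diff_diff : forall x, diff (diff x) = 0
}.
Arguments hom {C} : rename.
Arguments diff {C} : rename.

Definition graded_of_degree (C D : complex) (d : bideg)
    (f : {linear C -> D}) : Prop :=
  forall e x, hom e x -> hom (d + e) (f x).

Definition chain_map (C D : complex) (f : {linear C -> D}) : Prop :=
  graded_of_degree 0 f /\ forall x, f (diff x) = diff (f x).

Definition chain_homotopic (C D : complex) (f g : {linear C -> D}) : Prop :=
  exists h : {linear C -> D},
    graded_of_degree (1, 1) h /\
    forall x, f x - g x = diff (h x) + h (diff x).

Definition homotopy_equivalent (C D : complex) : Prop :=
  exists (f : {linear C -> D}) (g : {linear D -> C}),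
    [/\ chain_map f, chain_map g,
        chain_homotopic (g \o f) (idfun : {linear C -> C}) &
        chain_homotopic (f \o g) (idfun : {linear D -> D})].

Definition homogeneous_basis (C : complex) n (z : 'I_n -> C) : Prop :=
  (forall i, exists d, hom d (z i)) /\
  (forall x, exists! c : {ffun 'I_n -> FUV}, x = \sum_i c i *: z i).

Definition fg_free (C : complex) : Prop :=
  exists n (z : 'I_n -> C), homogeneous_basis z.

(* The complex with the roles of U and V interchanged: same group and
   differential, with p acting as swapUV p did, and gr_U, gr_V switched. *)

Definition swapped (M : lmodType FUV) : Type := M.

Section SwappedModule.
Variable M : lmodType FUV.

HB.instance Definition _ := GRing.Zmodule.on (swapped M).

Definition swapped_scale (p : FUV) (x : swapped M) : swapped M :=
  swapUV p *: (x : M).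

Fact swapped_scaleA p q x :
  swapped_scale p (swapped_scale q x) = swapped_scale (p * q) x.
Proof. by rewrite /swapped_scale scalerA rmorphM. Qed.

Fact swapped_scale1 : left_id 1 swapped_scale.
Proof. by move=> x; rewrite /swapped_scale rmorph1 scale1r. Qed.

Fact swapped_scaleDr : right_distributive swapped_scale +%R.
Proof. by move=> p x y; rewrite /swapped_scale scalerDr. Qed.

Fact swapped_scaleDl x : {morph swapped_scale^~ x : p q / p + q}.
Proof. by move=> p q; rewrite /swapped_scale rmorphD scalerDl. Qed.

HB.instance Definition _ := GRing.Zmodule_isLmodule.Build FUV (swapped M)
  swapped_scaleA swapped_scale1 swapped_scaleDr swapped_scaleDl.

Definition swapped_fun (f : M -> M) : swapped M -> swapped M := f.

Fact swapped_fun_linear (f : {linear M -> M}) : linear (swapped_fun f).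
Proof. by move=> p x y; rewrite /swapped_fun linearP. Qed.

HB.instance Definition _ (f : {linear M -> M}) :=
  GRing.isLinear.Build FUV (swapped M) (swapped M) _ (swapped_fun f)
    (swapped_fun_linear f).
End SwappedModule.

Definition swap_bideg (d : bideg) : bideg := (d.2, d.1).

Lemma swap_bidegK : involutive swap_bideg. Proof. by case. Qed.

Lemma monomial_bideg_swap (m : 'X_{1..2}) :
  monomial_bideg [multinom m (tperm ord0 ord_max i) | i < 2] =
    swap_bideg (monomial_bideg m).
Proof. by rewrite /monomial_bideg /swap_bideg !mnmE tpermL tpermR. Qed.

Lemma poly_homogeneous_swap d p :
  poly_homogeneous d p -> poly_homogeneous (swap_bideg d) (swapUV p).
Proof.
move=> hp m; rewrite mcoeff_msupp mcoeff_sym -mcoeff_msupp => /hp.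
by rewrite monomial_bideg_swap => <-; rewrite swap_bidegK.
Qed.

Section Bar.
Variable C : complex.
Let M : lmodType FUV := swapped C.
Let bar_hom (d : bideg) (x : M) : Prop := @hom C (swap_bideg d) x.
Let bar_diff : {linear M -> M} := swapped_fun (@diff C).

Fact bar_hom0 d : bar_hom d 0. Proof. exact: (@hom0 C). Qed.

Fact bar_homB d x y : bar_hom d x -> bar_hom d y -> bar_hom d (x - y).
Proof. exact: (@homB C). Qed.

Fact bar_homZ d e p x :
  poly_homogeneous d p -> bar_hom e x -> bar_hom (d + e) (p *: x).
Proof. by move=> /poly_homogeneous_swap hp hx; apply: (homZ hp hx). Qed.

Fact bar_hom_span x : exists (s : seq bideg) (c : bideg -> M),
  (forall d, bar_hom d (c d)) /\ x = \sum_(d <- s) c d.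
Proof.
have [s [c [hc ->]]] := @hom_span C x.
exists (map swap_bideg s), (c \o swap_bideg); split=> [d|]; first exact: hc.
by rewrite big_map; apply: eq_bigr => d _ /=; rewrite swap_bidegK.
Qed.

Fact bar_hom_indep (s : seq bideg) (c : bideg -> M) : uniq s ->
  (forall d, bar_hom d (c d)) -> \sum_(d <- s) c d = 0 ->
  forall d, d \in s -> c d = 0.
Proof.
move=> us hc s0 d ds.
have := @hom_indep C (map swap_bideg s) (c \o swap_bideg).
move=> /(_ _ _ _ (swap_bideg d)) /=; rewrite swap_bidegK; apply.
- by rewrite map_inj_uniq //; apply: (can_inj swap_bidegK).
- by move=> e; have := hc (swap_bideg e); rewrite /bar_hom swap_bidegK.
- by rewrite big_map -[RHS]s0; apply: eq_bigr => e _; rewrite swap_bidegK.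
- exact: map_f.
Qed.

Fact bar_diff_hom d x : bar_hom d x -> bar_hom (d - (1, 1)) (bar_diff x).
Proof. exact: (@diff_hom C). Qed.

Fact bar_diff_diff x : bar_diff (bar_diff x) = 0.
Proof. exact: (@diff_diff C). Qed.

Definition bar : complex := Complex bar_hom0 bar_homB bar_homZ bar_hom_span
  bar_hom_indep bar_diff_hom bar_diff_diff.
End Bar.

(* The quotients C/U and C/V.  Elements of C/s (s = U or V) are represented by
   elements of C, with equality in C/s being congruence modulo s C. *)

Section Quotient.
Variables (C : complex) (s t : FUV).

Definition eq_mod (x y : C) : Prop := exists w : C, x - y = s *: w.

Definition cycle_mod (x : C) : Prop := eq_mod (diff x) 0.

Definition boundary_mod (x : C) : Prop := exists y : C, eq_mod x (diff y).

(* The class of x in H_*(C/s) is t-torsion. *)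
Definition torsion_mod (x : C) : Prop :=
  exists k : nat, boundary_mod (t ^+ k *: x).

(* H_*(C/s)/(t-torsion) is isomorphic to F[t], by the map sending 1 to the
   class of a homogeneous cycle of C/s whose bidegree satisfies [deg];
   [horner_alg t p] is p(t). *)
Definition rank_one_homology (deg : bideg -> Prop) : Prop :=
  exists (d : bideg) (x : C),
    [/\ deg d, hom d x, cycle_mod x,
        (forall y, cycle_mod y ->
           exists p : {poly 'F_2}, torsion_mod (y - horner_alg t p *: x)) &
        (forall p : {poly 'F_2}, torsion_mod (horner_alg t p *: x) -> p = 0)].

(* Vertically simplified for (s, t) = (U, V), horizontally for (V, U) *)
Definition simplified n (z : 'I_n -> C) : Prop :=
  forall i : 'I_n,
    let outgoing :=
      exists (j : 'I_n) (a : nat), eq_mod (diff (z i)) (t ^+ a *: z j) in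
    let cycle :=
      eq_mod (diff (z i)) 0 /\
      forall (j j' : 'I_n) (a a' : nat),
        eq_mod (diff (z j)) (t ^+ a *: z i) ->
        eq_mod (diff (z j')) (t ^+ a' *: z i) -> (j, a) = (j', a') in
    (outgoing /\ ~ cycle) \/ (~ outgoing /\ cycle).
End Quotient.

Definition vertically_simplified (C : complex) n (z : 'I_n -> C) : Prop :=
  simplified U V z.

Definition horizontally_simplified (C : complex) n (z : 'I_n -> C) : Prop :=
  simplified V U z.

Definition admits_simplified_basis (C : complex) : Prop :=
  exists n (z : 'I_n -> C),
    [/\ homogeneous_basis z, vertically_simplified z &
        horizontally_simplified z].

Definition knot_floer_like (C : complex) : Prop :=
  [/\ fg_free C, homotopy_equivalent C (bar C),
      rank_one_homology C U V (fun d => d.1 = 0) &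
      rank_one_homology C V U (fun d => d.2 = 0)].

Section FreeComplex.
Variables (T : finType) (gr : T -> bideg).

Definition free_module : lmodType FUV := {ffun T -> FUV^o}.
Implicit Types x y : free_module.

Definition gen (g : T) : free_module := [ffun h => (h == g)%:R].

Definition free_hom (d : bideg) (x : free_module) : Prop :=
  forall g, poly_homogeneous (d - gr g) (x g).

Variable bd : T -> free_module.

Definition free_diff (x : free_module) : free_module :=
  \sum_g x g *: bd g.

Fact free_diff_linear : linear free_diff.
Proof.
move=> p x y; rewrite /free_diff scaler_sumr -big_split /=.
by apply: eq_bigr => g _; rewrite !ffunE scalerDl scalerA.
Qed.

HB.instance Definition _ := GRing.isLinear.Build FUV free_module free_module _
  free_diff free_diff_linear.

Lemma poly_homogeneous0 d : poly_homogeneous d 0.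
Proof. by move=> m; rewrite msupp0. Qed.

Lemma poly_homogeneousB d p q :
  poly_homogeneous d p -> poly_homogeneous d q -> poly_homogeneous d (p - q).
Proof.
move=> hp hq m /msuppB_le; rewrite mem_cat => /orP[]; [exact: hp|exact: hq].
Qed.

Lemma poly_homogeneousD d p q :
  poly_homogeneous d p -> poly_homogeneous d q -> poly_homogeneous d (p + q).
Proof.
move=> hp hq m /msuppD_le; rewrite mem_cat => /orP[]; [exact: hp|exact: hq].
Qed.

Lemma monomial_bidegD m n :
  monomial_bideg (m + n) = monomial_bideg m + monomial_bideg n.
Proof.
by rewrite /monomial_bideg !mnmDE !mulnDr !PoszD !opprD.
Qed.

Lemma poly_homogeneousM d e p q :
  poly_homogeneous d p -> poly_homogeneous e q ->
  poly_homogeneous (d + e) (p * q).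
Proof.
move=> hp hq m /msuppM_le /allpairsP[[m1 m2] /= [h1 h2 ->]].
by rewrite monomial_bidegD (hp _ h1) (hq _ h2).
Qed.

Lemma poly_homogeneous_mcoeff d p m :
  poly_homogeneous d p -> monomial_bideg m != d -> p@_m = 0.
Proof.
move=> hp; apply: contraNeq; rewrite -mcoeff_msupp => hm.
by apply/eqP/hp.
Qed.

Fact free_hom0 d : free_hom d 0.
Proof. by move=> g; rewrite ffunE; apply: poly_homogeneous0. Qed.

Fact free_homB d x y : free_hom d x -> free_hom d y -> free_hom d (x - y).
Proof.
by move=> hx hy g; rewrite !ffunE; apply: (poly_homogeneousB (hx g) (hy g)).
Qed.

Fact free_homD d x y : free_hom d x -> free_hom d y -> free_hom d (x + y).
Proof.
by move=> hx hy g; rewrite !ffunE; apply: (poly_homogeneousD (hx g) (hy g)).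
Qed.

Fact free_homZ d e p x :
  poly_homogeneous d p -> free_hom e x -> free_hom (d + e) (p *: x).
Proof.
move=> hp hx g; rewrite !ffunE -addrA.
exact: (poly_homogeneousM hp (hx g)).
Qed.

Lemma free_hom_sum d (I : Type) (r : seq I) (F : I -> free_module) :
  (forall i, free_hom d (F i)) -> free_hom d (\sum_(i <- r) F i).
Proof.
move=> hF; elim/big_rec: _ => [|i x _ hx]; first exact: free_hom0.
exact: free_homD.
Qed.

Fact free_hom_span x : exists (s : seq bideg) (c : bideg -> free_module),
  (forall d, free_hom d (c d)) /\ x = \sum_(d <- s) c d.
Proof.
pose c (d : bideg) : free_module :=
  [ffun g => \sum_(m <- msupp (x g) | monomial_bideg m == d - gr g)
               (x g)@_m *: 'X_[m]].
pose s := undup [seq monomial_bideg m + gr g | g <- enum T, m <- msupp (x g)].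
exists s, c; split=> [d g|].
  rewrite ffunE; elim/big_rec: _ => [|m p /eqP hm hp].
    exact: poly_homogeneous0.
  apply: poly_homogeneousD => // m' /msuppZ_le.
  by rewrite msuppX inE => /eqP ->.
apply/ffunP=> g; rewrite sum_ffunE [LHS]mpolyE.
under [RHS]eq_bigr do rewrite ffunE.
rewrite (exchange_big_dep predT) //= big_seq [RHS]big_seq.
apply: eq_bigr => m hm.
rewrite (big_rem (monomial_bideg m + gr g)) /=; last first.
  rewrite mem_undup; apply/allpairsPdep.
  by exists g, m; rewrite mem_enum.
rewrite addrK eqxx big_seq_cond big1 ?addr0 // => d.
rewrite mem_rem_uniq ?undup_uniq // inE => /andP[/andP[/= nd _] /eqP hd].
by case/eqP: nd; rewrite hd subrK.
Qed.

Fact free_hom_indep (s : seq bideg) (c : bideg -> free_module) : uniq s ->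
  (forall d, free_hom d (c d)) -> \sum_(d <- s) c d = 0 ->
  forall d, d \in s -> c d = 0.
Proof.
move=> us hc s0 d ds; apply/ffunP=> g; apply/mpolyP=> m; rewrite ffunE mcoeff0.
have [hm|hm] := eqVneq (monomial_bideg m) (d - gr g); last first.
  exact: poly_homogeneous_mcoeff (hc d g) hm.
have := congr1 (fun y : free_module => (y g : FUV)@_m) s0.
rewrite sum_ffunE ffunE mcoeff0 raddf_sum /= (big_rem d) //=.
rewrite big_seq_cond big1 ?addr0 // => e; rewrite andbT.
rewrite mem_rem_uniq // inE => /andP[/= ne _].
apply: poly_homogeneous_mcoeff (hc e g) _.
by rewrite hm (inj_eq (addIr _)) eq_sym.
Qed.

Hypothesis bd_hom : forall g, free_hom (gr g - (1, 1)) (bd g).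
Hypothesis bd_bd : forall g, free_diff (bd g) = 0.

Fact free_diff_hom d x :
  free_hom d x -> free_hom (d - (1, 1)) (free_diff x).
Proof.
move=> hx; apply: free_hom_sum => g.
by rewrite -(subrK (gr g) d) -addrA; apply: free_homZ.
Qed.

Fact free_diff_diff x : free_diff (free_diff x) = 0.
Proof.
rewrite [free_diff x]/free_diff linear_sum big1 // => g _.
by rewrite linearZ /= bd_bd scaler0.
Qed.

Definition free_complex : complex := @Complex free_module free_hom free_diff
  free_hom0 free_homB free_homZ free_hom_span free_hom_indep
  free_diff_hom free_diff_diff.
End FreeComplex.

(* The suffix p stands for a prime. *)

Inductive Pgen :=
  a | e1 | e2 | e3 | e4 | f1 | f2 | f3 | f4
    | e1p | e2p | e3p | e4p | f1p | f2p | f3p | f4p.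

Definition Pgen_enum : seq Pgen :=
  [:: a; e1; e2; e3; e4; f1; f2; f3; f4;
      e1p; e2p; e3p; e4p; f1p; f2p; f3p; f4p].

Definition Pgen_code (g : Pgen) : nat :=
  match g with
  | a => 0 | e1 => 1 | e2 => 2 | e3 => 3 | e4 => 4
  | f1 => 5 | f2 => 6 | f3 => 7 | f4 => 8
  | e1p => 9 | e2p => 10 | e3p => 11 | e4p => 12
  | f1p => 13 | f2p => 14 | f3p => 15 | f4p => 16
  end.

Lemma Pgen_codeK : pcancel Pgen_code (nth None (map Some Pgen_enum)).
Proof. by case. Qed.

HB.instance Definition _ := Countable.copy Pgen (pcan_type Pgen_codeK).

Lemma Pgen_enumP : Finite.axiom Pgen_enum. Proof. by case. Qed.

HB.instance Definition _ := isFinite.Build Pgen Pgen_enumP.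

(* The gradings other than gr(a) = gr(f4p) = (0, 0) are forced by the
   differential having bidegree (-1, -1). *)
Definition Pgr (g : Pgen) : bideg :=
  match g with
  | a => (0, 0)
  | e1 | f1 => (3, 3)
  | e2 | f2 => (4, 0)
  | e3 | f3 => (0, 4)
  | e4 | f4 => (1, 1)
  | e1p | f1p => (2, 2)
  | e2p | f2p => (3, -1)
  | e3p | f3p => (-1, 3)
  | e4p | f4p => (0, 0)
  end.

Definition Pbd (g : Pgen) : free_module Pgen :=
  match g with
  | a => 0
  | e1 => 0
  | f1 => 0
  | e2 => V ^+ 2 *: gen e1
  | f2 => V ^+ 2 *: gen f1
  | e3 => U ^+ 2 *: gen f1
  | f3 => U ^+ 2 *: (gen e1 + gen f1)
  | e4 => U ^+ 2 *: gen e2 + V ^+ 2 *: gen e3 + (U * V) *: (gen e1p + gen f1p)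
  | f4 => U ^+ 2 *: gen f2 + V ^+ 2 *: gen f3 + (U * V) *: gen e1p
  | e1p => (U * V) *: gen e1
  | f1p => (U * V) *: gen f1
  | e2p => V ^+ 2 *: gen e1p + (U * V) *: gen e2
  | f2p => V ^+ 2 *: gen f1p + (U * V) *: gen f2
  | e3p => U ^+ 2 *: gen f1p + (U * V) *: gen e3
  | f3p => U ^+ 2 *: (gen e1p + gen f1p) + (U * V) *: gen f3
  | e4p => U ^+ 2 *: gen e2p + V ^+ 2 *: gen e3p + (U * V) *: gen e4
  | f4p => U ^+ 2 *: gen f2p + V ^+ 2 *: gen f3p + (U * V) *: gen f4
  end.

Lemma poly_homogeneousX m : poly_homogeneous (monomial_bideg m) 'X_[m].
Proof. by move=> m'; rewrite msuppX inE => /eqP ->. Qed.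

Lemma poly_homogeneousU : poly_homogeneous (-2, 0) U.
Proof.
have := @poly_homogeneousX U_(ord0); congr poly_homogeneous.
by rewrite /monomial_bideg !mnm1E.
Qed.

Lemma poly_homogeneousV : poly_homogeneous (0, -2) V.
Proof.
have := @poly_homogeneousX U_(ord_max); congr poly_homogeneous.
by rewrite /monomial_bideg !mnm1E.
Qed.

Lemma gen_hom (T : finType) (gr : T -> bideg) g : free_hom gr (gr g) (gen g).
Proof.
move=> h; rewrite ffunE; case: eqP => [->|_]; last exact: poly_homogeneous0.
move=> m; rewrite subrr msupp1 inE => /eqP ->.
by rewrite /monomial_bideg !mnm0E.
Qed.

Fact Pbd_hom g : free_hom Pgr (Pgr g - (1, 1)) (Pbd g).
Proof.
have hZ p d e h : poly_homogeneous d p -> d + Pgr h = e ->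
    free_hom Pgr e (p *: gen h).
  by move=> hp <-; apply: free_homZ => //; apply: gen_hom.
have hU : poly_homogeneous (-4, 0) (U ^+ 2).
  exact: poly_homogeneousM poly_homogeneousU poly_homogeneousU.
have hV : poly_homogeneous (0, -4) (V ^+ 2).
  exact: poly_homogeneousM poly_homogeneousV poly_homogeneousV.
have hUV : poly_homogeneous (-2, -2) (U * V).
  exact: poly_homogeneousM poly_homogeneousU poly_homogeneousV.
have U2 h e : (-4, 0) + Pgr h = e -> free_hom Pgr e (U ^+ 2 *: gen h).
  exact: hZ.
have V2 h e : (0, -4) + Pgr h = e -> free_hom Pgr e (V ^+ 2 *: gen h).
  exact: hZ.
have UV h e : (-2, -2) + Pgr h = e -> free_hom Pgr e ((U * V) *: gen h).
  exact: hZ.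
case: g; rewrite /Pbd ?scalerDr.
all: repeat match goal with |- free_hom _ _ (_ + _) => apply: free_homD end.
all: match goal with
     | |- free_hom _ _ (U ^+ 2 *: _) => by apply: U2
     | |- free_hom _ _ (V ^+ 2 *: _) => by apply: V2
     | |- free_hom _ _ ((U * V) *: _) => by apply: UV
     | _ => exact: free_hom0
     end.
Qed.

Lemma free_diff_gen (T : finType) (bd : T -> free_module T) g :
  free_diff bd (gen g) = bd g.
Proof.
rewrite /free_diff (bigD1 g) //= ffunE eqxx scale1r big1 ?addr0 // => h /negPf.
by rewrite ffunE => ->; rewrite scale0r.
Qed.

Section SquareZero.
Variables (A : comNzRingType) (T : finType) (u v : A).
Variable d : {linear {ffun T -> A^o} -> {ffun T -> A^o}}.
Hypothesis two0 : 1 + 1 = 0 :> A.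
Implicit Types x y : {ffun T -> A^o}.

Lemma square_cycle (p : A) x :
  d x = 0 ->
  d (p *: x) = 0.
Proof.
move=> H0.
rewrite !(linearD, linearZ) /= ?H0.
by apply/ffunP=> h; rewrite !ffunE /GRing.scale /=; ring: two0.
Qed.

Lemma square_cycle2 (p : A) x y :
  d x = 0 -> d y = 0 ->
  d (p *: (x + y)) = 0.
Proof.
move=> H0 H1.
rewrite !(linearD, linearZ) /= ?H0 ?H1.
by apply/ffunP=> h; rewrite !ffunE /GRing.scale /=; ring: two0.
Qed.

Lemma square_2p x1p x2 x1 :
  d x1p = (u * v) *: x1 -> d x2 = v ^+ 2 *: x1 ->
  d (v ^+ 2 *: x1p + (u * v) *: x2) = 0.
Proof.
move=> H0 H1.
rewrite !(linearD, linearZ) /= ?H0 ?H1.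
by apply/ffunP=> h; rewrite !ffunE /GRing.scale /=; ring: two0.
Qed.

Lemma square_e3p y1p x3 y1 :
  d y1p = (u * v) *: y1 -> d x3 = u ^+ 2 *: y1 ->
  d (u ^+ 2 *: y1p + (u * v) *: x3) = 0.
Proof.
move=> H0 H1.
rewrite !(linearD, linearZ) /= ?H0 ?H1.
by apply/ffunP=> h; rewrite !ffunE /GRing.scale /=; ring: two0.
Qed.

Lemma square_f3p x1p y1p y3 x1 y1 :
  d x1p = (u * v) *: x1 -> d y1p = (u * v) *: y1 -> d y3 = u ^+ 2 *: (x1 + y1) ->
  d (u ^+ 2 *: (x1p + y1p) + (u * v) *: y3) = 0.
Proof.
move=> H0 H1 H2.
rewrite !(linearD, linearZ) /= ?H0 ?H1 ?H2.
by apply/ffunP=> h; rewrite !ffunE /GRing.scale /=; ring: two0.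
Qed.

Lemma square_e4 x2 x3 x1p y1p x1 y1 :
  d x2 = v ^+ 2 *: x1 -> d x3 = u ^+ 2 *: y1 -> d x1p = (u * v) *: x1 -> d y1p = (u * v) *: y1 ->
  d (u ^+ 2 *: x2 + v ^+ 2 *: x3 + (u * v) *: (x1p + y1p)) = 0.
Proof.
move=> H0 H1 H2 H3.
rewrite !(linearD, linearZ) /= ?H0 ?H1 ?H2 ?H3.
by apply/ffunP=> h; rewrite !ffunE /GRing.scale /=; ring: two0.
Qed.

Lemma square_f4 y2 y3 x1p x1 y1 :
  d y2 = v ^+ 2 *: y1 -> d y3 = u ^+ 2 *: (x1 + y1) -> d x1p = (u * v) *: x1 ->
  d (u ^+ 2 *: y2 + v ^+ 2 *: y3 + (u * v) *: x1p) = 0.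
Proof.
move=> H0 H1 H2.
rewrite !(linearD, linearZ) /= ?H0 ?H1 ?H2.
by apply/ffunP=> h; rewrite !ffunE /GRing.scale /=; ring: two0.
Qed.

Lemma square_e4p x2p x3p x4 x2 x3 x1p y1p :
  d x2p = v ^+ 2 *: x1p + (u * v) *: x2 -> d x3p = u ^+ 2 *: y1p + (u * v) *: x3 -> d x4 = u ^+ 2 *: x2 + v ^+ 2 *: x3 + (u * v) *: (x1p + y1p) ->
  d (u ^+ 2 *: x2p + v ^+ 2 *: x3p + (u * v) *: x4) = 0.
Proof.
move=> H0 H1 H2.
rewrite !(linearD, linearZ) /= ?H0 ?H1 ?H2.
by apply/ffunP=> h; rewrite !ffunE /GRing.scale /=; ring: two0.
Qed.

Lemma square_f4p y2p y3p y4 y2 y3 x1p y1p :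
  d y2p = v ^+ 2 *: y1p + (u * v) *: y2 -> d y3p = u ^+ 2 *: (x1p + y1p) + (u * v) *: y3 -> d y4 = u ^+ 2 *: y2 + v ^+ 2 *: y3 + (u * v) *: x1p ->
  d (u ^+ 2 *: y2p + v ^+ 2 *: y3p + (u * v) *: y4) = 0.
Proof.
move=> H0 H1 H2.
rewrite !(linearD, linearZ) /= ?H0 ?H1 ?H2.
by apply/ffunP=> h; rewrite !ffunE /GRing.scale /=; ring: two0.
Qed.

End SquareZero.

Fact Pbd_Pbd g : free_diff Pbd (Pbd g) = 0.
Proof.
have two0 : 1 + 1 = 0 :> FUV.
  by rewrite -mulr2n -mpolyC_nat (_ : 2%:R = 0 :> 'F_2) ?mpolyC0 //;
    apply/val_inj.
have D0 : free_diff Pbd 0 = 0 by exact: linear0.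
have D h : free_diff Pbd (gen h) = Pbd h by exact: free_diff_gen.
pose d : {linear free_module Pgen -> free_module Pgen} := free_diff Pbd.
have De1 := D e1; cbn [Pbd] in De1.
have De2 := D e2; cbn [Pbd] in De2.
have De3 := D e3; cbn [Pbd] in De3.
have De4 := D e4; cbn [Pbd] in De4.
have Df1 := D f1; cbn [Pbd] in Df1.
have Df2 := D f2; cbn [Pbd] in Df2.
have Df3 := D f3; cbn [Pbd] in Df3.
have Df4 := D f4; cbn [Pbd] in Df4.
have De1p := D e1p; cbn [Pbd] in De1p.
have De2p := D e2p; cbn [Pbd] in De2p.
have De3p := D e3p; cbn [Pbd] in De3p.
have Df1p := D f1p; cbn [Pbd] in Df1p.
have Df2p := D f2p; cbn [Pbd] in Df2p.
have Df3p := D f3p; cbn [Pbd] in Df3p.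
case: g; cbn [Pbd].
- exact: D0.
- exact: D0.
- exact: (square_cycle (d := d)) De1.
- exact: (square_cycle (d := d)) Df1.
- exact: (square_e4 (d := d) two0) De2 De3 De1p Df1p.
- exact: D0.
- exact: (square_cycle (d := d)) Df1.
- exact: (square_cycle2 (d := d)) De1 Df1.
- exact: (square_f4 (d := d) two0) Df2 Df3 De1p.
- exact: (square_cycle (d := d)) De1.
- exact: (square_2p (d := d) two0) De1p De2.
- exact: (square_e3p (d := d) two0) Df1p De3.
- exact: (square_e4p (d := d) two0) De2p De3p De4.
- exact: (square_cycle (d := d)) Df1.
- exact: (square_2p (d := d) two0) Df1p Df2.
- exact: (square_f3p (d := d) two0) De1p Df1p Df3.
- exact: (square_f4p (d := d) two0) Df2p Df3p Df4.
Qed.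

Definition P : complex := free_complex Pbd_hom Pbd_Pbd.

(* Main.v *)
(* If C ~ P and C has a basis z simplified in both directions, then the z_i that
   survive to H_*(C/(U,V)) map, under a homotopy equivalence C -> P, to a basis
   of P/(U,V).  Following vertical and horizontal arrows of length 2, such a
   z_i over the corner <e4, f4> is carried along both sides of the square to
   surviving elements over <e1, f1>.  The two routes differ by the monodromy of
   the square, a matrix of order 3 in GL_2(F_2), which permutes the three nonzero
   vectors cyclically.  The two or more images over <e4, f4> thus produce all three
   nonzero vectors of <e1, f1>, which are linearly dependent: a contradiction. *)
Require Import Defs.
From HB Require Import structures.
From mathcomp Require Import all_boot all_order all_algebra all_fingroup.
From mathcomp Require Import mpoly ring.

Set Implicit Arguments.
Unset Strict Implicit.
Unset Printing Implicit Defensive.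

Import GRing.Theory.
Local Open Scope ring_scope.

(** * Polynomials in U and V modulo one variable *)

Local Notation c0 := (mcoeff 0%MM : FUV -> 'F_2).

(* Sets the variable other than 'X_i to 0. *)
Definition axis (i : 'I_2) : {rmorphism FUV -> {poly 'F_2}} :=
  mmap (@polyC 'F_2) (fun j => if j == i then 'X else 0).

Lemma axisX i j : axis i 'X_j = if j == i then 'X else 0.
Proof. by rewrite /axis /= mmapX mmap1U. Qed.

Lemma c0X (i : 'I_2) : c0 'X_i = 0.
Proof. by rewrite mcoeffX mnm1_eq0. Qed.

Lemma horner_algMX (t : FUV) (p : {poly 'F_2}) c :
  horner_alg t (p * 'X + c%:P) = horner_alg t p * t + c%:A.
Proof. by rewrite rmorphD rmorphM /= horner_algX horner_algC. Qed.

Lemma c0_horner_alg i (p : {poly 'F_2}) : c0 (horner_alg ('X_i : FUV) p) = p`_0.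
Proof.
elim/poly_ind: p => [|p c _]; first by rewrite rmorph0 mcoeff0 coef0.
rewrite horner_algMX mcoeffD (rmorphM (mcoeff 0%MM)) /= c0X mulr0 add0r.
by rewrite mcoeffZ mcoeff1 eqxx mulr1 coefD coefMX coefC add0r.
Qed.

Lemma axis_horner_alg i (p : {poly 'F_2}) : axis i (horner_alg ('X_i : FUV) p) = p.
Proof.
elim/poly_ind: p => [|p c IH]; first by rewrite !rmorph0.
rewrite horner_algMX rmorphD rmorphM /= -/(axis i _) IH axisX eqxx; congr (_ + _).
by rewrite /axis /= mmapZ rmorph1 mulr1.
Qed.

Section AxisDecomposition.
Variables (i j : 'I_2).
Hypothesis ij : i != j.

Definition axis_decomposable (p : FUV) : Prop :=
  exists q, p = horner_alg ('X_i : FUV) (axis i p) + 'X_j * q.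

Lemma axis_decomposableC c : axis_decomposable c%:MP.
Proof.
exists 0; rewrite mulr0 addr0 /axis /= mmapC horner_algC.
by rewrite -[_%:A]mul_mpolyC mulr1.
Qed.

Lemma axis_decomposableM p1 p2 :
  axis_decomposable p1 -> axis_decomposable p2 -> axis_decomposable (p1 * p2).
Proof.
move=> [q1 h1] [q2 h2].
(* With [p1 = x + 'X_j * q1] and [p2 = y + 'X_j * q2], where [x], [y] are the axis parts, [p1 * p2 =
   x * y + 'X_j * (q1 * p2 + x * q2)]. *)
exists (q1 * p2 + horner_alg ('X_i : FUV) (axis i p1) * q2).
rewrite !rmorphM /= {1}h1 {1}h2 {3}h2.
move: (horner_alg _ (axis i p1)) (horner_alg _ (axis i p2)) => x y; ring.
Qed.

Lemma axis_decomposableX k : axis_decomposable 'X_k.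
Proof.
rewrite /axis_decomposable axisX; have [->|ki] := eqVneq k i.
  by exists 0; rewrite mulr0 addr0 horner_algX.
have -> : k = j.
  move: ij ki; case: i => [[|[|?]] ?] //; case: j => [[|[|?]] ?] //;
  by case: k => [[|[|?]] ?] // *; apply/val_inj.
by exists 1; rewrite rmorph0 add0r mulr1.
Qed.

Lemma axis_decomposableXn k n : axis_decomposable ('X_k ^+ n).
Proof.
elim: n => [|n IH]; first by rewrite expr0 -mpolyC1; exact: axis_decomposableC.
by rewrite exprS; exact: (axis_decomposableM (axis_decomposableX k) IH).
Qed.

(** Constants and variables decompose, and decompositions multiply and add, so every monomial and
    then every polynomial has one. This makes the kernel of [axis i] the ideal generated by
    ['X_j]. *)
Lemma axis_decomp p : axis_decomposable p.
Proof.
elim/mpolyind: p => [|c m p _ _ [q IH]].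
  by exists 0; rewrite !rmorph0 mulr0 addr0.
have h1 := axis_decomposableXn ord0 (m ord0).
have h2 := axis_decomposableXn (lift ord0 ord0) (m (lift ord0 ord0)).
have [q' h] := axis_decomposableM (axis_decomposableC c) (axis_decomposableM h1 h2).
exists (q' + q); rewrite -mul_mpolyC mpolyXE_id big_ord_recl big_ord1.
rewrite !raddfD /= {1}h {1}IH.
move: (horner_alg _ _) (horner_alg _ (axis i p)) => x y; ring.
Qed.

End AxisDecomposition.

Lemma axis0 i j (p : FUV) : i != j -> axis i p = 0 -> exists q, p = 'X_j * q.
Proof.
by move=> ij p0; have [q ->] := axis_decomp ij p; exists q; rewrite p0 rmorph0 add0r.
Qed.

Lemma coef0_axis i p : (axis i p)`_0 = c0 p.
Proof.
have [j ij] : exists j, i != j by exists (i + 1); case: i => [[|[|?]] ?].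
have [q {2}->] := axis_decomp ij p.
by rewrite mcoeffD (rmorphM (mcoeff 0%MM)) /= c0X mul0r addr0 c0_horner_alg.
Qed.

(** On the U-axis, a polynomial without constant term is a multiple of U; what the restriction to
    that axis forgets is a multiple of V. *)
Lemma c0_eq0 p : c0 p = 0 -> exists q r, p = U * q + V * r.
Proof.
move=> h; have [r e] := axis_decomp (isT : (ord0 : 'I_2) != ord_max) p.
have := coef0_axis ord0 p; rewrite h; move: e; move: (axis ord0 p) => s -> {h}.
elim/poly_ind: s => [|q c _].
  by move=> _; exists 0, r; rewrite rmorph0 mulr0.
rewrite horner_algMX coefD coefMX coefC /= add0r => ->.
by exists (horner_alg ('X_ord0 : FUV) q), r; rewrite scale0r addr0 [U * _]mulrC.
Qed.

(** * Simplified bases *)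

Definition in_UV (M : lmodType FUV) (x : M) : Prop :=
  exists y w, x = U *: y + V *: w.

Lemma in_UV_linear (M N : lmodType FUV) (f : {linear M -> N}) x :
  in_UV x -> in_UV (f x).
Proof. by case=> y [w ->]; exists (f y), (f w); rewrite linearD !linearZ. Qed.

Lemma in_UVD (M : lmodType FUV) (x y : M) : in_UV x -> in_UV y -> in_UV (x + y).
Proof.
move=> [x1 [x2 ->]] [y1 [y2 ->]]; exists (x1 + y1), (x2 + y2).
by rewrite !scalerDr addrACA.
Qed.

(** Coordinate functions are carried along with the vectors, over any finite index type, so that the
    same lemmas apply to a basis of [C] and to the generators of [P]. *)
Definition coordinates (M : lmodType FUV) (T : finType) (z : T -> M)
    (k : M -> T -> FUV) : Prop :=
  [/\ forall x, x = \sum_t k x t *: z t,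
      forall p x y t, k (p *: x + y) t = p * k x t + k y t &
      forall s t, k (z s) t = (s == t)%:R].

Lemma gen_coordinates (T : finType) :
  coordinates (@gen T) (fun y : free_module T => y).
Proof.
split=> [x|p x y t|s t]; last by rewrite ffunE eq_sym.
  apply/ffunP=> g; rewrite sum_ffunE.
  under eq_bigr => h _ do rewrite !ffunE /GRing.scale /=.
  rewrite (bigD1 g) //= eqxx mulr1 big1 ?addr0 // => h /negPf hg.
  by rewrite eq_sym hg mulr0.
by rewrite !ffunE.
Qed.

Lemma basis_coordinates (C : complex) n (z : 'I_n -> C) :
  homogeneous_basis z -> exists k, coordinates z k.
Proof.
case=> _ hz.
(* The boolean equality lets [xchoose] extract coefficients; their uniqueness then gives linearity
   of the chosen coordinates. *)
have hP (x : C) : exists c : {ffun 'I_n -> FUV}, x == \sum_i c i *: z i.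
  by have [c [-> _]] := hz x; exists c.
have kP x : x = \sum_i xchoose (hP x) i *: z i := eqP (xchooseP (hP x)).
have uniq_coord x (c : {ffun 'I_n -> FUV}) :
    x = \sum_i c i *: z i -> xchoose (hP x) = c.
  by move=> xc; have [c' [_ u]] := hz x; rewrite -(u _ (kP x)) (u _ xc).
exists (fun (x : C) i => xchoose (hP x) i); split=> [x|p x y t|s t]; first exact: kP.
- rewrite (uniq_coord _ [ffun i => p * xchoose (hP x) i + xchoose (hP y) i]).
    by rewrite ffunE.
  rewrite {1}[x]kP {1}[y]kP scaler_sumr -big_split; apply: eq_bigr => i _ /=.
  by rewrite ffunE scalerDl scalerA.
- rewrite (uniq_coord _ [ffun i => (s == i)%:R]) ?ffunE //.
  rewrite (bigD1 s) //= ffunE eqxx scale1r big1 ?addr0 // => i /negPf si.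
  by rewrite ffunE eq_sym si scale0r.
Qed.

Section Coordinates.
Variables (M : lmodType FUV) (T : finType) (z : T -> M) (k : M -> T -> FUV).
Hypothesis zk : coordinates z k.

Lemma coord_sum x : x = \sum_t k x t *: z t. Proof. by case: zk. Qed.

Lemma coord0 t : k 0 t = 0.
Proof.
(* Linearity at [p = -1], [x = y = 0] reads [k 0 t = - k 0 t + k 0 t]. *)
case: zk => _ /(_ (-1) 0 0 t) + _; rewrite scaler0 addr0 mulN1r.
by move=> ->; rewrite addNr.
Qed.

Lemma coordD x y t : k (x + y) t = k x t + k y t.
Proof. by case: zk => _ /(_ 1 x y t) + _; rewrite scale1r mul1r. Qed.

Lemma coordZ p x t : k (p *: x) t = p * k x t.
Proof. by case: zk => _ /(_ p x 0 t) + _; rewrite addr0 coord0 addr0. Qed.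

Lemma coordB x y t : k (x - y) t = k x t - k y t.
Proof. by rewrite coordD -scaleN1r coordZ mulN1r. Qed.

Lemma coord_big (I : Type) (r : seq I) (Q : pred I) (F : I -> M) t :
  k (\sum_(i <- r | Q i) F i) t = \sum_(i <- r | Q i) k (F i) t.
Proof.
apply: (big_morph (fun x => k x t)); first by move=> x y; exact: coordD.
exact: coord0.
Qed.

Lemma coord_delta s t : k (z s) t = (s == t)%:R. Proof. by case: zk. Qed.

Lemma coord_comb (I : finType) (e : I -> T) (c : I -> FUV) i : injective e ->
  k (\sum_l c l *: z (e l)) (e i) = c i.
Proof.
move=> ei; rewrite coord_big (bigD1 i) //= coordZ coord_delta eqxx mulr1.
rewrite big1 ?addr0 // => l li.
by rewrite coordZ coord_delta (inj_eq ei) (negPf li) mulr0.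
Qed.

Lemma c0_coord_in_UV x t : in_UV x -> c0 (k x t) = 0.
Proof.
case=> y [w ->]; rewrite coordD !coordZ mcoeffD !(rmorphM (mcoeff 0%MM)) /=.
by rewrite !c0X !mul0r addr0.
Qed.

Lemma in_UV_coord x : (forall t, c0 (k x t) = 0) -> in_UV x.
Proof.
move=> h; rewrite [x]coord_sum; elim/big_ind: _ => [|y w|t _].
- by exists 0, 0; rewrite !scaler0 addr0.
- exact: in_UVD.
- have [q [r ->]] := c0_eq0 (h t); exists (q *: z t), (r *: z t).
  by rewrite scalerDl !scalerA.
Qed.

Lemma axis_coord_scale i j x t : i != j -> axis i (k ('X_j *: x) t) = 0.
Proof. by move=> ij; rewrite coordZ rmorphM /= axisX eq_sym (negPf ij) mul0r. Qed.

Lemma axis_coord_eq0 i j x : i != j ->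
  (forall t, axis i (k x t) = 0) -> exists w, x = 'X_j *: w.
Proof.
move=> ij h; rewrite [x]coord_sum; elim/big_ind: _ => [|y w [y' ->] [w' ->]|t _].
- by exists 0; rewrite scaler0.
- by exists (y' + w'); rewrite scalerDr.
- by have [q ->] := axis0 ij (h t); exists (q *: z t); rewrite scalerA.
Qed.

End Coordinates.

(** By freeness the question reduces to single coordinates, and ['X_j] divides a polynomial exactly
    when [axis i] kills it. Computations in C/U or C/V thus become computations with one-variable
    polynomials. *)
Lemma eq_mod_coord (C : complex) (T : finType) (z : T -> C) k i j (x y : C) :
  coordinates z k -> i != j ->
  eq_mod 'X_j x y <-> forall t, axis i (k x t) = axis i (k y t).
Proof.
move=> zk ij; split=> [[w xy] t|h].
  apply/eqP; rewrite -subr_eq0 -rmorphB -(coordB zk) xy.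
  by rewrite (axis_coord_scale zk).
apply: (axis_coord_eq0 zk ij) => t.
by rewrite (coordB zk) rmorphB /= h subrr.
Qed.

Lemma eq_mod_linear (C D : complex) (f : {linear C -> D}) s x y :
  eq_mod s x y -> eq_mod s (f x) (f y).
Proof. by case=> w h; exists (f w); rewrite -linearB h linearZ. Qed.

Lemma eq_mod_trans (C : complex) s (x y w : C) :
  eq_mod s x y -> eq_mod s y w -> eq_mod s x w.
Proof.
by move=> [p hp] [q hq]; exists (p + q); rewrite scalerDr -hp -hq addrA subrK.
Qed.

Lemma eq_modZ (C : complex) s p (x y : C) :
  eq_mod s x y -> eq_mod s (p *: x) (p *: y).
Proof.
by case=> w h; exists (p *: w); rewrite -scalerBr h !scalerA mulrC.
Qed.

(** * Basis elements that survive to the homology of C/(U,V) *)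

Section SimplifiedBasis.
Variables (C : complex) (n : nat) (z : 'I_n -> C) (k : C -> 'I_n -> FUV).
Hypothesis zk : coordinates z k.

Definition unit_arrow l i : 'F_2 := c0 (k (diff (z l)) i).

(* The classes of the surviving z_i form a basis of H_*(C/(U,V)) as soon as z
   is simplified in one of the two directions. *)
Definition surviving i : bool :=
  [forall l, (unit_arrow i l == 0) && (unit_arrow l i == 0)].

Lemma survivingP i :
  reflect ((forall l, unit_arrow i l = 0) /\ (forall l, unit_arrow l i = 0))
          (surviving i).
Proof.
apply: (iffP forallP) => [h|[h1 h2] l]; last by rewrite h1 h2 eqxx.
by split=> l; have /andP[/eqP h1 /eqP h2] := h l.
Qed.

Lemma c0_coord_diff x i :
  c0 (k (diff x) i) = \sum_l c0 (k x l) * unit_arrow l i.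
Proof.
rewrite {1}[x](coord_sum zk) linear_sum /= (coord_big zk) raddf_sum /=.
by apply: eq_bigr => l _; rewrite linearZ /= (coordZ zk) (rmorphM (mcoeff 0%MM)).
Qed.

(** Over F_2 every linear combination is a subset sum, so this is linear independence of the images
    modulo (U,V). In the homotopy identity for [x], the sum over [S], the term [f (g x)] dies by
    assumption, [h (diff x)] because no unit arrow leaves [S], and the [i]-th coordinate of
    [diff (h x)] because no unit arrow enters [i]; yet the [i]-th coordinate of [x] is 1. *)
Lemma surviving_independent (Q : complex) (f : {linear Q -> C})
    (g : {linear C -> Q}) (S : {set 'I_n}) :
  chain_homotopic (f \o g) (idfun : {linear C -> C}) ->
  {in S, forall i, surviving i} -> in_UV (g (\sum_(i in S) z i)) -> S = set0.
Proof.
case=> h [_ hh] sS gS; apply/setP=> i; rewrite inE; apply/negP=> iS.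
set x := \sum_(i in S) z i in gS.
have c0x l : c0 (k x l) = (l \in S)%:R.
  rewrite /x (coord_big zk) raddf_sum /=.
  have [lS|lS] := boolP (l \in S).
    rewrite (bigD1 l) //= (coord_delta zk) eqxx mcoeff1 eqxx big1 ?addr0 //.
    by move=> m /andP[_ /negPf ml]; rewrite (coord_delta zk) ml mcoeff0.
  rewrite big1 // => m mS; rewrite (coord_delta zk) (_ : (m == l) = false).
    by rewrite mcoeff0.
  by apply: contraNF lS => /eqP <-.
have dx : in_UV (diff x).
  apply: (in_UV_coord zk) => t; rewrite c0_coord_diff big1 // => l _.
  rewrite c0x; case: (boolP (l \in S)) => [/sS/survivingP[-> _]|_];
  by rewrite ?mulr0 ?mul0r.
have := congr1 (fun y => c0 (k y i)) (hh x).
rewrite /= (coordB zk) (coordD zk) mcoeffB mcoeffD.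
rewrite (c0_coord_in_UV zk i (in_UV_linear f gS)).
rewrite (c0_coord_in_UV zk i (in_UV_linear h dx)) c0x iS c0_coord_diff big1.
  by move/eqP; rewrite addr0 sub0r oppr_eq0 oner_eq0.
by move=> l _; have /survivingP[_ ->] := sS _ iS; rewrite mulr0.
Qed.

Section Direction.
Variables i j : 'I_2.
Hypothesis ij : i != j.
Hypothesis zs : simplified 'X_j 'X_i z.
Implicit Types l m : 'I_n.

Local Notation s := ('X_j : FUV).
Local Notation t := ('X_i : FUV).

Lemma unit_arrow_eq_mod l x m :
  eq_mod s (diff (z l)) x -> unit_arrow l m = c0 (k x m).
Proof.
by move=> /(eq_mod_coord _ _ zk ij)/(_ m) h; rewrite /unit_arrow -!(coef0_axis i) h.
Qed.

Lemma unit_arrow_basis l m m' a :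
  eq_mod s (diff (z l)) (t ^+ a *: z m) ->
  unit_arrow l m' = ((a == 0%N) && (m == m'))%:R.
Proof.
move=> /unit_arrow_eq_mod ->; rewrite (coordZ zk) (coord_delta zk).
rewrite (rmorphM (mcoeff 0%MM)) rmorphXn /= c0X expr0n.
by case: (a == _); case: (m == _); rewrite ?mcoeff1 ?mcoeff0 ?eqxx /= ?mul0r ?mul1r.
Qed.

Lemma unit_arrow_neq0 l m :
  unit_arrow l m != 0 -> eq_mod s (diff (z l)) (t ^+ 0 *: z m).
Proof.
case: (zs l) => /= [[[m' [a h]] _]|[_ [h _]]]; last first.
  by rewrite (unit_arrow_eq_mod m h) (coord0 zk) mcoeff0 eqxx.
rewrite (unit_arrow_basis m h).
by move: h; have [->|] := eqVneq a 0%N; have [->|] := eqVneq m' m.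
Qed.

(** If [z m] had an outgoing arrow of length [b] to [z m'], then [diff_diff] would make
    [t ^+ (a + b) *: z m'] vanish modulo [s], which freeness forbids. Hence [z m] falls under the
    cycle alternative, which also provides uniqueness. *)
Lemma arrow_target_cycle l m a :
  eq_mod s (diff (z l)) (t ^+ a *: z m) ->
  eq_mod s (diff (z m)) 0 /\
  forall l' b, eq_mod s (diff (z l')) (t ^+ b *: z m) -> (l', b) = (l, a).
Proof.
move=> h; case: (zs m) => /= [[[m' [b h']] _]|[_ [h' u]]]; last first.
  by split=> // l' c h''; apply: u.
have := eq_mod_linear diff h; rewrite diff_diff linearZ /=.
move=> /eq_mod_trans/(_ (eq_modZ (t ^+ a) h')).
rewrite scalerA -exprD => /(eq_mod_coord _ _ zk ij)/(_ m').
rewrite (coordZ zk) (coord_delta zk) eqxx mulr1 (coord0 zk) rmorph0 rmorphXn /=.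
by rewrite axisX eqxx => /esym/eqP; rewrite expf_eq0 polyX_eq0 andbF.
Qed.

(** Spanning of Q/(U,V) in dual form: no nonzero functional kills the images of all surviving
    elements. Modulo (U,V), [x] equals [g (f x)], and an element [z l] occurring in [f x] either
    survives or is the target of a unit arrow; in the latter case [g (z l)] is a boundary modulo
    [s], so [lam] kills it. *)
Lemma surviving_spanning (Q : complex) (f : {linear Q -> C})
    (g : {linear C -> Q}) (lam : Q -> 'F_2) x :
  chain_map f -> chain_map g ->
  chain_homotopic (g \o f) (idfun : {linear Q -> Q}) ->
  (forall y : Q, in_UV (diff y)) ->
  {morph lam : y w / y + w} -> (forall p y, lam (p *: y) = c0 p * lam y) ->
  lam x != 0 -> exists2 l, surviving l & lam (g (z l)) != 0.
Proof.
move=> [_ fd] [_ gd] [h [_ hh]] dQ lamD lamZ.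
have lam_UV y : in_UV y -> lam y = 0.
  by case=> y1 [y2 ->]; rewrite lamD !lamZ !c0X !mul0r addr0.
have lam0 : lam 0 = 0 by rewrite -[0 in LHS](scaler0 _ U) lamZ c0X mul0r.
have dfx : in_UV (diff (f x)) by rewrite -fd; apply: in_UV_linear.
(* Modulo (U,V), [f x] is a cycle. A unit arrow from [l] to [m] is the only one ending at [m], so no
   other term can cancel its contribution. *)
have row l : c0 (k (f x) l) != 0 -> forall m, unit_arrow l m = 0.
  move=> xl m; apply/eqP; apply: contraTT xl => lm; rewrite negbK.
  have := c0_coord_diff (f x) m; rewrite (c0_coord_in_UV zk m dfx).
  rewrite (bigD1 l) //= big1 => [|l' ll'].
    by rewrite addr0 => /esym/eqP; rewrite mulf_eq0 (negPf lm) orbF.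
  apply/eqP; rewrite mulf_eq0; apply/orP; right.
  apply: contraTT ll' => l'm; rewrite negbK.
  have [_ u] := arrow_target_cycle (unit_arrow_neq0 lm).
  by have [->] := u _ _ (unit_arrow_neq0 l'm).
move=> lx; apply/exists_inP; apply: contraNT lx => /exists_inPn noS.
have e : g (f x) = diff (h x) + h (diff x) + x by rewrite -hh /= subrK.
have -> : lam x = lam (g (f x)).
  by rewrite e lamD [X in X + _]lam_UV ?add0r //; apply: in_UVD => //;
    apply: in_UV_linear.
rewrite [f x](coord_sum zk) linear_sum /= (big_morph lam lamD lam0) big1 // => l _.
rewrite linearZ lamZ; apply/eqP; rewrite mulf_eq0; apply/norP => -[xl gl].
have [sl|] := boolP (surviving l); first by move/negP: (noS l sl); apply.
rewrite negb_forall => /existsP[m]; rewrite negb_and (row l xl) eqxx /=.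
case/unit_arrow_neq0 => w /(congr1 g); rewrite linearB gd !linearZ /= expr0 scale1r.
move=> /esym/eqP; rewrite eq_sym subr_eq => /eqP ml.
have : lam (diff (g (z m))) = 0 by apply: lam_UV.
rewrite ml lamD lamZ c0X mul0r add0r => gl0.
by rewrite gl0 eqxx in gl.
Qed.

(* An arrow of length 1 or less out of a surviving z_l is excluded because every
   differential of Q is divisible by t^2 modulo s. *)
Lemma surviving_arrow (T : finType) (Q : complex) (q : T -> Q) (kq : Q -> T -> FUV)
    (f : {linear Q -> C}) (g : {linear C -> Q}) l r :
  coordinates q kq -> chain_map g ->
  chain_homotopic (f \o g) (idfun : {linear C -> C}) ->
  (forall y r b, (b < 2)%N -> (axis i (kq (diff y) r))`_b = 0) ->
  surviving l -> (axis i (kq (diff (g (z l))) r))`_2 != 0 ->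
  exists2 m, surviving m &
    forall r', c0 (kq (g (z m)) r') = (axis i (kq (diff (g (z l))) r'))`_2.
Proof.
move=> qk [_ gd] fg dQ sl lr.
have [[m [b lm]]|l0] : (exists m b, eq_mod s (diff (z l)) (t ^+ b *: z m)) \/
    eq_mod s (diff (z l)) 0.
- by case: (zs l) => [[[m [b h]] _]|[_ [h _]]]; [left; exists m, b|right].
- have [m0 u] := arrow_target_cycle lm.
  have bP : b != 0%N.
    have /survivingP[/(_ m) + _] := sl.
    by rewrite (unit_arrow_basis m lm) eqxx andbT; case: eqP.
  (* Nothing leaves [m], a cycle modulo [s]; a unit arrow into [m] would coincide with the arrow
     from [l], whose length is positive. *)
  have sm : surviving m.
    apply/survivingP; split=> l'; first by rewrite (unit_arrow_eq_mod l' m0)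
      (coord0 zk) mcoeff0.
    apply/eqP; apply: contraNT bP => /unit_arrow_neq0/u[_ <-] //.
  have e r' : axis i (kq (diff (g (z l))) r') = 'X^b * axis i (kq (g (z m)) r').
    have := eq_mod_linear g lm; rewrite gd linearZ /=.
    move=> /(eq_mod_coord _ _ qk ij)/(_ r') ->.
    by rewrite (coordZ qk) rmorphM rmorphXn /= axisX eqxx.
  (* Length 1 would put [g (z m)] in (U,V)Q, contradicting independence for the singleton of [m];
     length 3 or more would make the coefficient of [t^2] vanish. Length 2 remains. *)
  case: b lm bP u e => [|[|[|b]]] // lm _ u e.
  + have /setP/(_ m) : [set m] = set0.
      apply: (surviving_independent fg) => [l'|]; first by rewrite inE => /eqP ->.
      rewrite big_set1; apply: (in_UV_coord qk) => r'.
      have := dQ (g (z l)) r' 1%N isT.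
      by rewrite e mulrC coefMXn /= coef0_axis.
    by rewrite !inE eqxx.
  + by exists m => // r'; rewrite e mulrC coefMXn /= coef0_axis.
  + by move: lr; rewrite e mulrC coefMXn.
- move: lr; have := eq_mod_linear g l0; rewrite gd linear0.
  move=> /(eq_mod_coord _ _ qk ij)/(_ r) ->.
  by rewrite (coord0 qk) rmorph0 coef0 eqxx.
Qed.

End Direction.
End SimplifiedBasis.

(** * The differential of P in coordinates *)

Lemma sum_Pgen (A : zmodType) (F : Pgen -> A) :
  \sum_g F g = \sum_(g <- Pgen_enum) F g.
Proof.
apply/perm_big/uniq_perm => [||g]; first exact: index_enum_uniq.
- by [].
- by rewrite mem_index_enum; case: g.
Qed.

Section DifferentialCoordinates.
Variables (A : comNzRingType) (u v : A).

(** The differential of P read by rows. The ring and the values of U and V are parameters, so that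
    it can be specialised to [u = 0] or [v = 0] and transported along [axis] and [swapUV]. *)
Definition Pdiff_at (y : Pgen -> A) (h : Pgen) : A :=
  match h with
  | a => 0
  | e1 => v ^+ 2 * y e2 + u ^+ 2 * y f3 + u * v * y e1p
  | f1 => v ^+ 2 * y f2 + u ^+ 2 * (y e3 + y f3) + u * v * y f1p
  | e2 => u ^+ 2 * y e4 + u * v * y e2p
  | f2 => u ^+ 2 * y f4 + u * v * y f2p
  | e3 => v ^+ 2 * y e4 + u * v * y e3p
  | f3 => v ^+ 2 * y f4 + u * v * y f3p
  | e4 => u * v * y e4p
  | f4 => u * v * y f4p
  | e1p => u * v * (y e4 + y f4) + v ^+ 2 * y e2p + u ^+ 2 * y f3p
  | f1p => u * v * y e4 + v ^+ 2 * y f2p + u ^+ 2 * (y e3p + y f3p)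
  | e2p => u ^+ 2 * y e4p
  | f2p => u ^+ 2 * y f4p
  | e3p => v ^+ 2 * y e4p
  | f3p => v ^+ 2 * y f4p
  | e4p | f4p => 0
  end.

(** The same differential read by columns, in the shape of [Pbd]; it links [Pbd] to the rows
    [Pdiff_at]. *)
Definition Pmatrix (h g : Pgen) : A :=
  let d i := (h == i)%:R in
  match g with
  | a | e1 | f1 => 0
  | e2 => v ^+ 2 * d e1
  | f2 => v ^+ 2 * d f1
  | e3 => u ^+ 2 * d f1
  | f3 => u ^+ 2 * (d e1 + d f1)
  | e4 => u ^+ 2 * d e2 + v ^+ 2 * d e3 + u * v * (d e1p + d f1p)
  | f4 => u ^+ 2 * d f2 + v ^+ 2 * d f3 + u * v * d e1p
  | e1p => u * v * d e1
  | f1p => u * v * d f1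
  | e2p => v ^+ 2 * d e1p + u * v * d e2
  | f2p => v ^+ 2 * d f1p + u * v * d f2
  | e3p => u ^+ 2 * d f1p + u * v * d e3
  | f3p => u ^+ 2 * (d e1p + d f1p) + u * v * d f3
  | e4p => u ^+ 2 * d e2p + v ^+ 2 * d e3p + u * v * d e4
  | f4p => u ^+ 2 * d f2p + v ^+ 2 * d f3p + u * v * d f4
  end.

Lemma Pmatrix_sum y h : \sum_g y g * Pmatrix h g = Pdiff_at y h.
Proof.
rewrite sum_Pgen !big_cons big_nil; case: h;
  cbn -[GRing.natmul GRing.mul GRing.add GRing.exp GRing.zero GRing.one];
  rewrite ?(mulr1n, mulr0n) //; ring.
Qed.
End DifferentialCoordinates.

Section FreeModuleCoordinates.
Variable T : finType.
Implicit Types x y : free_module T.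

Lemma free_at0 h : (0 : free_module T) h = 0.
Proof. by rewrite ffunE. Qed.

Lemma free_atD x y h : (x + y) h = x h + y h.
Proof. by rewrite ffunE. Qed.

Lemma free_atZ p x h : (p *: x) h = p * x h.
Proof. by rewrite ffunE. Qed.

Lemma gen_at (g h : T) : gen g h = (h == g)%:R.
Proof. by rewrite ffunE. Qed.
End FreeModuleCoordinates.

Lemma Pbd_at g h : Pbd g h = Pmatrix U V h g.
Proof.
have Z p g' : (p *: gen g' : free_module Pgen) h = p * (h == g')%:R.
  by rewrite free_atZ gen_at.
have ZD p g' g'' : (p *: (gen g' + gen g'') : free_module Pgen) h =
    p * ((h == g')%:R + (h == g'')%:R).
  by rewrite free_atZ free_atD !gen_at.
case: g; cbn [Pbd Pmatrix].
- by rewrite free_at0.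
- by rewrite free_at0.
- exact: Z.
- exact: Z.
- by rewrite free_atD free_atD; congr (_ + _ + _); [apply: Z | apply: Z | apply: ZD].
- by rewrite free_at0.
- exact: Z.
- exact: ZD.
- by rewrite free_atD free_atD; congr (_ + _ + _); apply: Z.
- exact: Z.
- by rewrite free_atD; congr (_ + _); apply: Z.
- by rewrite free_atD; congr (_ + _); apply: Z.
- by rewrite free_atD free_atD; congr (_ + _ + _); apply: Z.
- exact: Z.
- by rewrite free_atD; congr (_ + _); apply: Z.
- by rewrite free_atD; congr (_ + _); [apply: ZD | apply: Z].
- by rewrite free_atD free_atD; congr (_ + _ + _); apply: Z.
Qed.

Lemma Pdiff_coord (y : P) h : (diff y : free_module Pgen) h = Pdiff_at U V y h.
Proof.
rewrite -Pmatrix_sum sum_ffunE; apply: eq_bigr => g _.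
by rewrite free_atZ Pbd_at.
Qed.

(** * The monodromy obstruction *)

Section ReducedDifferential.
Variable A : comNzRingType.

(** The differential of P/U divided by V^2; [Phoriz] is that of P/V divided by U^2. All arrows of
    P/U and P/V have length 2, and the monodromy comes from the two targets of [f3] in [Phoriz]. *)
Definition Pvert (y : Pgen -> A) (h : Pgen) : A :=
  match h with
  | e1 => y e2 | f1 => y f2 | e3 => y e4 | f3 => y f4
  | e1p => y e2p | f1p => y f2p | e3p => y e4p | f3p => y f4p
  | _ => 0
  end.

Definition Phoriz (y : Pgen -> A) (h : Pgen) : A :=
  match h with
  | e1 => y f3 | f1 => y e3 + y f3 | e2 => y e4 | f2 => y f4
  | e1p => y f3p | f1p => y e3p + y f3p | e2p => y e4p | f2p => y f4p
  | _ => 0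
  end.

Lemma Pdiff_at_vert v y h : Pdiff_at 0 v y h = v ^+ 2 * Pvert y h.
Proof. by case: h; cbn [Pdiff_at Pvert]; ring. Qed.

Lemma Pdiff_at_horiz u y h : Pdiff_at u 0 y h = u ^+ 2 * Phoriz y h.
Proof. by case: h; cbn [Pdiff_at Phoriz]; ring. Qed.

Lemma Pdiff_at_morph (B : comNzRingType) (f : {rmorphism A -> B}) u v y h :
  f (Pdiff_at u v y h) = Pdiff_at (f u) (f v) (f \o y) h.
Proof.
by case: h; cbn [Pdiff_at];
  rewrite /= ?(rmorph0 f, rmorphD f, rmorphM f, rmorphXn f).
Qed.
End ReducedDifferential.

Lemma axis_Pdiff_vert (y : P) h :
  axis ord_max ((diff y : free_module Pgen) h) =
    'X^2 * Pvert (axis ord_max \o y) h.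
Proof.
by rewrite Pdiff_coord Pdiff_at_morph -Pdiff_at_vert /U /V !axisX.
Qed.

Lemma axis_Pdiff_horiz (y : P) h :
  axis ord0 ((diff y : free_module Pgen) h) =
    'X^2 * Phoriz (axis ord0 \o y) h.
Proof.
by rewrite Pdiff_coord Pdiff_at_morph -Pdiff_at_horiz /U /V !axisX.
Qed.

Lemma coef2_Pdiff_vert (y : P) h :
  (axis ord_max ((diff y : free_module Pgen) h))`_2 =
    Pvert (fun r => c0 ((y : free_module Pgen) r)) h.
Proof.
by rewrite axis_Pdiff_vert mulrC coefMXn; case: h; cbn [Pvert] => /=;
  rewrite ?(coef0, coef0_axis).
Qed.

Lemma coef2_Pdiff_horiz (y : P) h :
  (axis ord0 ((diff y : free_module Pgen) h))`_2 =
    Phoriz (fun r => c0 ((y : free_module Pgen) r)) h.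
Proof.
by rewrite axis_Pdiff_horiz mulrC coefMXn; case: h; cbn [Phoriz] => /=;
  rewrite ?(coefD, coef0, coef0_axis).
Qed.

Lemma P_coordinates : @coordinates P Pgen (@gen Pgen)
  (fun y : P => (y : free_module Pgen)).
Proof. exact: gen_coordinates. Qed.

Lemma diff_P_in_UV (y : P) : in_UV (diff y).
Proof.
apply: (in_UV_coord P_coordinates) => t.
by rewrite -(coef0_axis ord0) axis_Pdiff_horiz mulrC coefMXn.
Qed.

Lemma F2_cases (x : 'F_2) : x = 0 \/ x = 1.
Proof. by case: x => [[|[|?]] ?] //; [left|right]; apply: val_inj. Qed.

(** * Carrying surviving elements around the square of P *)

Section NoSimplifiedBasis.
Variables (C : complex) (n : nat) (z : 'I_n -> C).
Variables (f : {linear P -> C}) (g : {linear C -> P}) (k : C -> 'I_n -> FUV).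
Hypotheses (zk : coordinates z k) (zhom : forall i, exists d, Defs.hom d (z i)).
Hypotheses (zvert : vertically_simplified z) (zhoriz : horizontally_simplified z).
Hypotheses (fmap : chain_map f) (gmap : chain_map g).
Hypothesis gf_id : chain_homotopic (g \o f) (idfun : {linear P -> P}).
Hypothesis fg_id : chain_homotopic (f \o g) (idfun : {linear C -> C}).

Local Notation surviving := (surviving z k).
Let w l r : 'F_2 := c0 ((g (z l) : free_module Pgen) r).

Lemma surviving_vert l r : surviving l -> Pvert (w l) r != 0 ->
  exists2 m, surviving m & forall r', w m r' = Pvert (w l) r'.
Proof.
move=> sl; rewrite -coef2_Pdiff_vert => lr.
have [//|y r' [|[|?]] // _|m sm mP] := surviving_arrow (i := ord_max) (j := ord0)
  zk _ zvert P_coordinates gmap fg_id _ sl lr.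
- by rewrite axis_Pdiff_vert mulrC coefMXn.
- by rewrite axis_Pdiff_vert mulrC coefMXn.
by exists m => // r'; rewrite -coef2_Pdiff_vert -mP.
Qed.

Lemma surviving_horiz l r : surviving l -> Phoriz (w l) r != 0 ->
  exists2 m, surviving m & forall r', w m r' = Phoriz (w l) r'.
Proof.
move=> sl; rewrite -coef2_Pdiff_horiz => lr.
have [//|y r' [|[|?]] // _|m sm mP] := surviving_arrow (i := ord0) (j := ord_max)
  zk _ zhoriz P_coordinates gmap fg_id _ sl lr.
- by rewrite axis_Pdiff_horiz mulrC coefMXn.
- by rewrite axis_Pdiff_horiz mulrC coefMXn.
by exists m => // r'; rewrite -coef2_Pdiff_horiz -mP.
Qed.

Let hit p q := exists2 m, surviving m & w m e1 = p /\ w m f1 = q.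

(* The two paths around the square, from the corner (e4, f4) to (e1, f1),
   differ by the order 3 monodromy (p, q) |-> (q, p + q). *)
Lemma monodromy l : surviving l -> (w l e4 != 0) || (w l f4 != 0) ->
  hit (w l e4) (w l f4) /\ hit (w l f4) (w l e4 + w l f4).
Proof.
move=> sl lP; split.
- have [m sm mP] : exists2 m, surviving m & forall r', w m r' = Phoriz (w l) r'.
    by case/orP: lP => lP; [apply: (surviving_horiz (r := e2))
                           | apply: (surviving_horiz (r := f2))].
  have [m' sm' m'P] : exists2 m', surviving m' & forall r', w m' r' = Pvert (w m) r'.
    by case/orP: lP => lP; [apply: (surviving_vert (r := e1))
                           | apply: (surviving_vert (r := f1))] => //=; rewrite mP.
  by exists m' => //; rewrite !m'P /= !mP.
- have [m sm mP] : exists2 m, surviving m & forall r', w m r' = Pvert (w l) r'.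
    by case/orP: lP => lP; [apply: (surviving_vert (r := e3))
                           | apply: (surviving_vert (r := f3))].
  have [m' sm' m'P] : exists2 m', surviving m' & forall r', w m' r' = Phoriz (w m) r'.
    (* The vector at (e1, f1) is going to be [(w l f4, w l e4 + w l f4)]; the case split selects a
       nonzero entry of it. *)
    have [wf|wf] := eqVneq (w l f4) 0.
      by apply: (surviving_horiz (r := f1)); rewrite //= !mP /= wf addr0; move: lP;
         rewrite wf eqxx orbF.
    by apply: (surviving_horiz (r := e1)); rewrite //= mP.
  by exists m' => //; rewrite !m'P /= !mP.
Qed.

Lemma spanning_corner (lam : P -> 'F_2) r :
  {morph lam : y w / y + w} -> (forall p y, lam (p *: y) = c0 p * lam y) ->
  lam (gen r) != 0 -> exists2 l, surviving l & lam (g (z l)) != 0.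
Proof.
exact: (surviving_spanning zk (isT : ord_max != ord0 :> 'I_2) zvert fmap gmap gf_id
  diff_P_in_UV).
Qed.

(** Two surviving elements with independent vectors v, v' over (e4, f4) suffice. With M the
    monodromy, v' is Mv or M^2 v, so v, Mv, v', Mv' exhaust the three nonzero vectors. *)
Lemma hit_all p q : (p != 0) || (q != 0) -> hit p q.
Proof.
pose at_ r (y : P) : 'F_2 := c0 ((y : free_module Pgen) r).
have atD r : {morph at_ r : y w / y + w}.
  by move=> y y'; rewrite /at_ free_atD mcoeffD.
have atZ r p' y : at_ r (p' *: y) = c0 p' * at_ r y.
  by rewrite /at_ free_atZ (rmorphM (mcoeff 0%MM)).
have at_gen r r' : at_ r (gen r') = (r == r')%:R.
  by rewrite /at_ gen_at; case: eqP => _; rewrite ?mcoeff1 ?mcoeff0 ?eqxx.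
have two : 1 + 1 = 0 :> 'F_2 by apply: val_inj.
have [l sl le] : exists2 l, surviving l & w l e4 != 0.
  apply: (spanning_corner (lam := at_ e4) (r := e4)) => //.
  by rewrite at_gen eqxx oner_eq0.
have [//|h1 h2] := monodromy sl; first by rewrite le.
(* Since [w l e4 = 1] in F_2, this functional is the determinant of the vectors of [l] and [l'] over
   (e4, f4). *)
have [l' sl' l'P] : exists2 l', surviving l' &
    w l' f4 + w l e4 * w l f4 * w l' e4 != 0.
  apply: (spanning_corner (r := f4)
    (lam := fun y => at_ f4 y + w l e4 * w l f4 * at_ e4 y)).
  - by move=> y y'; rewrite !atD mulrDr addrACA.
  - by move=> p' y; rewrite !atZ mulrDr mulrCA.
  - by rewrite !at_gen eqxx mulr0 addr0 oner_eq0.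
have [|h1' h2'] := monodromy sl'.
  by apply: contraNT l'P; rewrite negb_or !negbK => /andP[/eqP -> /eqP ->];
    rewrite mulr0 addr0.
move: le l'P h1 h2 h1' h2'.
by case: (F2_cases (w l e4)) => ->; case: (F2_cases (w l f4)) => ->;
   case: (F2_cases (w l' e4)) => ->; case: (F2_cases (w l' f4)) => ->;
   case: (F2_cases p) => ->; case: (F2_cases q) => ->;
   rewrite ?(mulr0, mulr1, mul0r, addr0, add0r, two, eqxx).
Qed.

(** A nonzero constant coefficient at [r] forces the degree of [z m] to be [Pgr r], and e1, f1 are
    the only generators in degree (3,3). *)
Lemma hit_degree m r : (w m e1 != 0) || (w m f1 != 0) -> w m r != 0 ->
  (r == e1) || (r == f1).
Proof.
have [d zd] := zhom m; have [gg _] := gmap.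
have wd r' : w m r' != 0 -> d = Pgr r'.
  have := gg _ _ zd r'; rewrite add0r => hd wr.
  have := hd 0%MM; rewrite mcoeff_msupp => /(_ wr).
  have -> : monomial_bideg 0%MM = 0 by rewrite /monomial_bideg !mnm0E.
  by move=> /esym/eqP; rewrite subr_eq0 => /eqP.
by case/orP=> /wd dE /wd; rewrite dE; case: r.
Qed.

Lemma simplified_contradiction : False.
Proof.
have [|m10 s10 [e10 f10]] := hit_all (p := 1) (q := 0); first by rewrite oner_eq0.
have [|m01 s01 [e01 f01]] := hit_all (p := 0) (q := 1).
  by rewrite oner_eq0 orbT.
have [|m11 s11 [e11 f11]] := hit_all (p := 1) (q := 1); first by rewrite oner_eq0.
have d1 : m10 != m01 by apply/eqP => h; move: e10; rewrite h e01.
have d2 : m10 != m11 by apply/eqP => h; move: f10; rewrite h f11.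
have d3 : m01 != m11 by apply/eqP => h; move: e01; rewrite h e11.
have : [set m10; m01; m11] = set0.
  apply: (surviving_independent zk fg_id) => [l|].
    by rewrite !inE -orbA => /or3P[] /eqP ->.
  rewrite -setUA !big_setU1 ?inE ?negb_or ?d1 ?d2 ?d3 // big_set1 !linearD /=.
  apply: (in_UV_coord P_coordinates) => r.
  rewrite !free_atD !mcoeffD -!/(w _ r).
  (* At e1 and at f1 exactly two of the three images contribute a 1, which cancel in F_2; all other
     coordinates vanish by degree. *)
  have [/orP[/eqP ->|/eqP ->]|nr] := boolP ((r == e1) || (r == f1)).
  - by rewrite e10 e01 e11; apply: val_inj.
  - by rewrite f10 f01 f11; apply: val_inj.
  have w0 m : (w m e1 != 0) || (w m f1 != 0) -> w m r = 0.
    by move=> hm; apply/eqP; apply: contraNT nr; apply: hit_degree.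
  by rewrite !w0 ?e10 ?f10 ?e01 ?f01 ?e11 ?f11 ?oner_eq0 ?orbT // !addr0.
by move/setP/(_ m10); rewrite !inE eqxx.
Qed.
End NoSimplifiedBasis.

(** * Symmetry of P *)

Lemma fg_free_P : fg_free P.
Proof.
exists #|{: Pgen}|, (fun i => gen (enum_val i)); split=> [i|x].
  by exists (Pgr (enum_val i)); apply: gen_hom.
exists [ffun i => (x : free_module Pgen) (enum_val i)]; split=> [|c xc].
  rewrite {1}[x](coord_sum P_coordinates).
  rewrite (reindex (fun i : 'I_#|{: Pgen}| => enum_val i)) /=.
    by apply: eq_bigr => i _; rewrite ffunE.
  by apply: onW_bij; apply: enum_val_bij.
apply/ffunP=> i; rewrite ffunE xc.
exact: (coord_comb P_coordinates c i enum_val_inj).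
Qed.

Section FlipCoordinates.
Variable A : comNzRingType.
Implicit Types y : Pgen -> A.

(** On generators: e1 goes to e1 + f1, f1 is fixed, and e2 with f3, f2 with e3, e4 with f4 are
    exchanged, likewise with primes. The image of e1 is dictated by exchanging the arrow of e2,
    which ends at e1, with that of f3, which ends at e1 + f1. *)
Definition flip_at y (h : Pgen) : A :=
  match h with
  | a => y a
  | e1 => y e1 | f1 => y e1 + y f1
  | e2 => y f3 | f2 => y e3 | e3 => y f2 | f3 => y e2
  | e4 => y f4 | f4 => y e4
  | e1p => y e1p | f1p => y e1p + y f1p
  | e2p => y f3p | f2p => y e3p | e3p => y f2p | f3p => y e2p
  | e4p => y f4p | f4p => y e4p
  end.

Lemma flip_atP p y y' h :
  flip_at (fun g => p * y g + y' g) h = p * flip_at y h + flip_at y' h.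
Proof. by case: h; cbn [flip_at] => //; ring. Qed.

Hypothesis two0 : 1 + 1 = 0 :> A.

Lemma flip_atK y h : flip_at (flip_at y) h = y h.
Proof. by case: h; cbn [flip_at] => //; ring: two0. Qed.

Lemma flip_at_diff u v y h :
  Pdiff_at u v (flip_at y) h = flip_at (Pdiff_at v u y) h.
Proof. by case: h; cbn [flip_at Pdiff_at] => //; ring: two0. Qed.
End FlipCoordinates.

Lemma flip_at_morph (A B : comNzRingType) (s : {rmorphism A -> B}) y h :
  s (flip_at y h) = flip_at (s \o y) h.
Proof. by case: h; cbn [flip_at]; rewrite /= ?(rmorphD s). Qed.

Lemma flip_at_ext (A : comNzRingType) (y y' : Pgen -> A) h :
  y =1 y' -> flip_at y h = flip_at y' h.
Proof. by move=> e; case: h; cbn [flip_at]; rewrite ?e. Qed.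

Lemma swapUV_U : swapUV U = V.
Proof.
rewrite /swapUV /U /V /= msymX; congr 'X_[_].
apply/mnmP => i; rewrite mnmE !mnm1E tpermV.
have [->|->] : i = ord0 \/ i = ord_max.
- by case: i => [[|[|?]] ?] //; [left|right]; apply: val_inj.
- by rewrite tpermL.
- by rewrite tpermR.
Qed.

Lemma swapUV_V : swapUV V = U.
Proof. by rewrite -swapUV_U swapUVK. Qed.

Lemma FUV_two : 1 + 1 = 0 :> FUV.
Proof.
rewrite -mulr2n -mpolyC_nat (_ : 2%:R = 0 :> 'F_2) ?mpolyC0 //.
exact: val_inj.
Qed.

(* Hidden behind an opaque proof: unification would otherwise unfold flip y = flip y'
   down to the implementation of polynomials. *)
Fact flip_exists : {F : free_module Pgen -> free_module Pgen |
  forall y h, F y h = flip_at (swapUV \o y) h}.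
Proof.
exists (fun y : free_module Pgen => [ffun h => flip_at (swapUV \o y) h]) => y h.
by rewrite ffunE.
Qed.

Definition flip : free_module Pgen -> free_module Pgen := sval flip_exists.

Lemma flip_at_coord y h : flip y h = flip_at (swapUV \o y) h.
Proof. exact: (svalP flip_exists). Qed.

Lemma flipK : involutive flip.
Proof.
move=> y; apply/ffunP => h; rewrite flip_at_coord.
rewrite -[RHS](flip_atK FUV_two); apply: flip_at_ext => g /=.
rewrite flip_at_coord flip_at_morph; apply: flip_at_ext => g' /=.
exact: swapUVK.
Qed.

Lemma flip_semilinear p y y' : flip (p *: y + y') = swapUV p *: flip y + flip y'.
Proof.
apply/ffunP => h; rewrite [RHS]free_atD [X in _ = X + _]free_atZ.
rewrite !flip_at_coord -flip_atP; apply: flip_at_ext => g /=.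
by rewrite free_atD free_atZ rmorphD rmorphM.
Qed.

Lemma flipD : {morph flip : y y' / y + y'}.
Proof.
by move=> y y'; have := flip_semilinear 1 y y'; rewrite rmorph1 !scale1r.
Qed.

Lemma flip0 : flip 0 = 0.
Proof. by apply: (addrI (flip 0)); rewrite -flipD !addr0. Qed.

Lemma flipZ p y : flip (p *: y) = swapUV p *: flip y.
Proof. by have := flip_semilinear p y 0; rewrite flip0 !addr0. Qed.

Lemma flipB : {morph flip : y y' / y - y'}.
Proof.
by move=> y y'; rewrite -scaleN1r flipD flipZ rmorphN1 scaleN1r.
Qed.

Lemma flip_diff (y : P) : flip (diff y) = diff (flip y : P).
Proof.
apply/ffunP => h; rewrite Pdiff_coord flip_at_coord.
have -> : Pdiff_at U V (flip y) h = Pdiff_at U V (flip_at (swapUV \o y)) h.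
  by case: h; cbn [Pdiff_at]; rewrite ?flip_at_coord.
rewrite (flip_at_diff FUV_two); apply: flip_at_ext => g /=.
by rewrite Pdiff_coord Pdiff_at_morph swapUV_U swapUV_V.
Qed.

Lemma flip_hom d (y : P) : Defs.hom d y -> Defs.hom (swap_bideg d) (flip y : P).
Proof.
move=> yd h; rewrite flip_at_coord.
have e g : Pgr h = swap_bideg (Pgr g) ->
    poly_homogeneous (swap_bideg d - Pgr h) (swapUV ((y : free_module Pgen) g)).
  by move=> ->; apply: (poly_homogeneous_swap (yd g)).
by case: h e => e; cbn [flip_at]; try apply: poly_homogeneousD; apply: e.
Qed.

(** A map semilinear over [swapUV] on P is linear between P and [bar P]. Since [flip] is an
    involution, it gives both directions of an isomorphism. *)
Definition flip_to_bar (y : P) : bar P := flip y.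
Definition flip_from_bar (y : bar P) : P := flip y.

Fact flip_to_bar_linear : linear flip_to_bar.
Proof. by move=> p y y'; exact: flip_semilinear. Qed.

Fact flip_from_bar_linear : linear flip_from_bar.
Proof.
move=> p y y'; rewrite /flip_from_bar (flip_semilinear (swapUV p)).
by rewrite swapUVK.
Qed.

HB.instance Definition _ := GRing.isLinear.Build FUV P (bar P) _
  flip_to_bar flip_to_bar_linear.
HB.instance Definition _ := GRing.isLinear.Build FUV (bar P) P _
  flip_from_bar flip_from_bar_linear.

Lemma chain_homotopic_eq (C D : complex) (f g : {linear C -> D}) :
  f =1 g -> chain_homotopic f g.
Proof.
move=> fg; exists (\0 : {linear C -> D}); split=> [d x _|x].
  exact: hom0.
by rewrite /= linear0 addr0 fg subrr.
Qed.

Lemma P_symmetric : homotopy_equivalent P (bar P).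
Proof.
exists flip_to_bar, flip_from_bar; split.
- split=> [d y yd|y]; last exact: flip_diff.
  by rewrite add0r; exact: flip_hom yd.
- split=> [d y yd|y]; last exact: flip_diff.
  by rewrite add0r; have := @flip_hom (swap_bideg d) y yd; rewrite swap_bidegK.
- by apply: chain_homotopic_eq => y; exact: flipK.
- by apply: chain_homotopic_eq => y; exact: flipK.
Qed.

(** * Homology of P/U and P/V *)

Lemma diff_gen_a : diff (gen a : P) = 0.
Proof. exact: free_diff_gen. Qed.

Section VerticalLift.
Variable A : comNzRingType.
Implicit Types y : Pgen -> A.

(** A contraction of the part of P/U away from [a]: each target of [Pvert] is sent back to its
    source. *)
Definition vert_lift y (h : Pgen) : A :=
  match h with
  | e2 => y e1 | f2 => y f1 | e4 => y e3 | f4 => y f3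
  | e2p => y e1p | f2p => y f1p | e4p => y e3p | f4p => y f3p
  | _ => 0
  end.

Lemma vert_liftP y h : (forall r, Pvert y r = 0) ->
  y h - y a * (a == h)%:R = Pvert (vert_lift y) h.
Proof.
move=> cyc.
have := (cyc e1, cyc f1, cyc e3, cyc f3, (cyc e1p, cyc f1p, cyc e3p, cyc f3p)).
case: h; cbn [Pvert vert_lift]; case=> [[[[c1 c2] c3] c4] [[[c5 c6] c7] c8]];
  by rewrite /= ?mulr1 ?mulr0 ?subr0 ?subrr.
Qed.

End VerticalLift.

Lemma vert_lift_morph (A B : comNzRingType) (s : {rmorphism A -> B}) y h :
  s (vert_lift y h) = vert_lift (s \o y) h.
Proof. by case: h; cbn [vert_lift]; rewrite ?(rmorph0 s). Qed.

Lemma Pvert_ext (A : comNzRingType) (y y' : Pgen -> A) h :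
  y =1 y' -> Pvert y h = Pvert y' h.
Proof. by move=> e; case: h; cbn [Pvert]; rewrite ?e. Qed.

(** In P/U the sixteen generators other than [a] are paired off by arrows of length 2, so they
    contribute only V-torsion, while [a] is isolated. *)
Lemma P_rank_one_vert : rank_one_homology P U V (fun d => d.1 = 0).
Proof.
have mn : (ord_max : 'I_2) != ord0 by [].
exists (0, 0), (gen a); split => //.
- exact: (@gen_hom _ Pgr a).
- by exists 0; rewrite diff_gen_a subrr scaler0.
(* The polynomial is the coordinate of [y] at [a] on the V-axis. The exponent 2 is the arrow length:
   V^2 times the remainder is the boundary of its lift. *)
- move=> y yc; exists (axis ord_max ((y : free_module Pgen) a)), 2%N.
  pose w : P := [ffun h => vert_lift (y : free_module Pgen) h].
  exists w; apply/(eq_mod_coord _ _ P_coordinates mn) => h.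
  have cyc r : Pvert (axis ord_max \o (y : free_module Pgen)) r = 0.
    have /(eq_mod_coord _ _ P_coordinates mn)/(_ r) := yc.
    rewrite axis_Pdiff_vert free_at0 rmorph0 => /eqP.
    by rewrite mulf_eq0 expf_eq0 polyX_eq0 => /eqP.
  have wE : Pvert (axis ord_max \o (w : free_module Pgen)) h =
      Pvert (vert_lift (axis ord_max \o (y : free_module Pgen))) h.
    by apply: Pvert_ext => r; rewrite -vert_lift_morph /= ffunE.
  rewrite axis_Pdiff_vert wE -(vert_liftP _ cyc).
  rewrite (coordZ P_coordinates) (coordB P_coordinates).
  rewrite (coordZ P_coordinates) (coord_delta P_coordinates).
  rewrite rmorphM rmorphXn /= axisX eqxx rmorphB rmorphM /= axis_horner_alg.
  by rewrite rmorph_nat.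
(* No boundary has a component at [a], so comparing coordinates there gives ['X^m * p = 0]. *)
- move=> p [m [y]] /(eq_mod_coord _ _ P_coordinates mn)/(_ a).
  rewrite axis_Pdiff_vert mulr0 !(coordZ P_coordinates) (coord_delta P_coordinates).
  rewrite eqxx mulr1 rmorphM rmorphXn /= axis_horner_alg axisX eqxx => /eqP.
  by rewrite mulf_eq0 expf_eq0 polyX_eq0 andbF => /eqP.
Qed.

Lemma swapUV_horner_alg (t : FUV) (p : {poly 'F_2}) :
  swapUV (horner_alg t p) = horner_alg (swapUV t) p.
Proof.
elim/poly_ind: p => [|p c IH]; first by rewrite !rmorph0.
rewrite !horner_algMX rmorphD rmorphM IH; congr (_ + _).
by rewrite /swapUV /= linearZ /= rmorph1.
Qed.

Lemma flip_eq_mod s (x y : P) :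
  eq_mod s x y -> eq_mod (swapUV s) (flip x : P) (flip y : P).
Proof. by case=> w xy; exists (flip w : P); rewrite -flipZ -xy flipB. Qed.

Lemma flip_cycle_mod s (y : P) :
  cycle_mod s y -> cycle_mod (swapUV s) (flip y : P).
Proof. by rewrite /cycle_mod => /flip_eq_mod; rewrite flip_diff flip0. Qed.

Lemma flip_torsion_mod s t (y : P) :
  torsion_mod s t y -> torsion_mod (swapUV s) (swapUV t) (flip y : P).
Proof.
case=> m [w /flip_eq_mod]; rewrite flip_diff flipZ rmorphXn => h.
by exists m, (flip w : P).
Qed.

(** The symmetry [flip] interchanges P/U with P/V together with their cycles and torsion classes, so
    the vertical computation transfers. *)
Lemma P_rank_one_horiz : rank_one_homology P V U (fun d => d.2 = 0).
Proof.
have [d [x [d1 xd xc span free]]] := P_rank_one_vert.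
exists (swap_bideg d), (flip x : P); split.
- exact: d1.
- exact: flip_hom.
- by rewrite -swapUV_U; apply: flip_cycle_mod.
- move=> y /flip_cycle_mod; rewrite swapUV_V => /span[p].
  move=> /flip_torsion_mod; rewrite flipB flipZ flipK swapUV_horner_alg.
  by rewrite swapUV_U swapUV_V; exists p.
- move=> p /flip_torsion_mod; rewrite flipZ flipK swapUV_horner_alg.
  by rewrite swapUV_U swapUV_V; apply: free.
Qed.

Theorem theorem1p4 :
  knot_floer_like P /\
  ~ (exists C : complex,
       [/\ knot_floer_like C,
           homotopy_equivalent P C &
           admits_simplified_basis C]).
Proof.
split.
  split; [exact: fg_free_P | exact: P_symmetric | exact: P_rank_one_vert |
          exact: P_rank_one_horiz].
case=> C [_ [f [g [fm gm gf fg]]] [n [z [zb zv zh]]]].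
have [k zk] := basis_coordinates zb; have [zhom _] := zb.
exact: (simplified_contradiction zk zhom zv zh fm gm gf fg).
Qed.
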